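(* Let $G$ be a graph of order $n$ and size $m$. Then $$\psi_3(G) \leq \frac{4n+m}{9}.$$
   Context: Graphs are finite, simple and undirected. The order of $G$ is $n=|V(G)|$ and its size is $m=|E(G)|$. $P_k$ denotes the path with $k$ vertices. A $k$-path vertex cover of $G$ is a set $T\subseteq V(G)$ such that $G-T$ contains no (not necessarily induced) subgraph isomorphic to $P_k$. $\psi_k(G)$ is the minimum cardinality of a $k$-path vertex cover of $G$. *)

(* Defs.v *)
From mathcomp Require Import all_boot all_order all_algebra.

Set Implicit Arguments.
Unset Strict Implicit.
Unset Printing Implicit Defensive.

Record sgraph := SGraph {
  vertex :> finType;
  adj : rel vertex;
  adj_sym : symmetric adj;
  adj_irr : irreflexive adj
}.

Definition graph_order (G : sgraph) : nat := #|G|.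

Definition edges (G : sgraph) : {set {set G}} :=
  [set [set x; y] | x in G, y in G & adj x y].

Definition graph_size (G : sgraph) : nat := #|edges G|.

(* H is isomorphic to a (not necessarily induced) subgraph of G exactly when
   there is an injective map V(H) -> V(G) sending edges to edges. *)
Definition has_subgraph (H G : sgraph) : bool :=
  [exists f : {ffun H -> G},
     injectiveb f && [forall x, forall y, adj x y ==> adj (f x) (f y)]].

Section PathGraph.
Variable k : nat.

Definition path_adj (i j : 'I_k) : bool := (i.+1 == j) || (j.+1 == i).

Lemma path_adj_sym : symmetric path_adj.
Proof. by move=> i j; rewrite /path_adj orbC. Qed.

Lemma path_adj_irr : irreflexive path_adj.
Proof. by move=> i; rewrite /path_adj orbb; apply/negbTE; rewrite neq_ltn ltnSn orbT. Qed.

(* P_k has k vertices, hence k - 1 edges. *)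
Definition path_graph : sgraph := SGraph path_adj_sym path_adj_irr.

End PathGraph.

Section VertexDeletion.
Variables (G : sgraph) (T : {set G}).

Definition del_adj (x y : {x : G | x \notin T}) : bool := adj (val x) (val y).

Lemma del_adj_sym : symmetric del_adj.
Proof. by move=> x y; apply: adj_sym. Qed.

Lemma del_adj_irr : irreflexive del_adj.
Proof. by move=> x; apply: adj_irr. Qed.

Definition del_vertices : sgraph := SGraph del_adj_sym del_adj_irr.

End VertexDeletion.

Definition path_vertex_cover (k : nat) (G : sgraph) (T : {set G}) : bool :=
  ~~ has_subgraph (path_graph k) (del_vertices T).

(* The minimum is attained for k > 0, see [psiP]. For k = 0 the empty path is
   contained in every graph, so there is no cover and the value is junk. *)
Definition psi (k : nat) (G : sgraph) : nat :=
  #|[arg min_(T < [set: G] | path_vertex_cover k T) #|T| ]|.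

Lemma path_vertex_cover_setT (k : nat) (G : sgraph) :
  0 < k -> path_vertex_cover k [set: G].
Proof.
move=> k_gt0; apply/existsP => -[f _].
by have := valP (f (Ordinal k_gt0)); rewrite inE.
Qed.

Lemma psiP (k : nat) (G : sgraph) : 0 < k ->
  (exists2 T : {set G}, path_vertex_cover k T & #|T| = psi k G) /\
  (forall T : {set G}, path_vertex_cover k T -> psi k G <= #|T|).
Proof.
move=> k_gt0; rewrite /psi.
case: arg_minnP => [|T coverT minT]; first exact: path_vertex_cover_setT.
by split=> //; exists T.
Qed.

(* Main.v *)
Require Import Defs.
From mathcomp Require Import all_boot all_order all_algebra.
From mathcomp Require Import zify.

(** The complement of a 3-path vertex cover is a set [D] inducing a subgraph of
    maximum degree at most 1 (a dissociation set), so the task is to find a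
    large [D].  Two mechanisms produce such sets.

    Deleting vertices of large degree: removing a vertex of degree at least
    [k] costs one vertex of the cover and lowers [alpha * n + beta * m] by at
    least [alpha + beta * k].  If this is at least 1, the bound
    [psi_3 <= alpha * n + beta * m] need only be shown for graphs of maximum
    degree less than [k] ([delete_large_degrees]).

    A maximum cut: in a graph of maximum degree 3 every vertex has at most one
    neighbour on its own side, so both sides are dissociation sets and
    [psi_3 <= n / 2] ([half_dissociation]).

    Now three bounds are obtained, each from the previous ones.
    - [psi_3 <= m / 2]: delete vertices of degree at least 2; what remains is a
      dissociation set.
    - [psi_3 <= (2 n + m) / 6]: delete vertices of degree at least 4.  In
      maximum degree 3, use [n / 2] if [n <= m] and [m / 2] if [m <= n].
    - [psi_3 <= (4 n + m) / 9]: delete vertices of degree at least 5.  In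
      maximum degree 4 one has [m <= 2 n], and then
      [(2 n + m) / 6 <= (4 n + m) / 9].

    The inductions run over the vertex subsets [A] of a fixed graph, with
    induced degrees, and use the degree sum [2 m] in place of [m]. *)

Set Implicit Arguments.
Unset Strict Implicit.
Unset Printing Implicit Defensive.

Section Dissociation.
Variable G : sgraph.
Implicit Types (A B D X : {set G}) (x y : G).

Definition deg_in A x : nat := #|[set y in A | adj x y]|.

Definition deg_sum A : nat := \sum_(x in A) deg_in A x.

Definition dissociated D : Prop := forall x, x \in D -> deg_in D x <= 1.

(** * Degrees in induced subgraphs *)

Lemma deg_in_sum A x : deg_in A x = \sum_(y in A) adj x y.
Proof.
rewrite /deg_in -sum1_card big_mkcond [RHS]big_mkcond /=.
by apply: eq_bigr => y _; rewrite inE; case: (y \in A); case: (adj x y).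
Qed.

Lemma deg_inU1 B x : deg_in (x |: B) x = deg_in B x.
Proof.
congr #|pred_of_set _|; apply/setP=> y; rewrite !inE.
by case: eqP => [->|//]; rewrite adj_irr !andbF.
Qed.

(** An edge from [x] to [B] adds 1 to the degree of each of its two ends. *)
Lemma deg_sumU1 B x : x \notin B ->
  deg_sum (x |: B) = deg_sum B + 2 * deg_in B x.
Proof.
move=> xB; rewrite /deg_sum big_setU1 //= deg_inU1.
have -> : \sum_(y in B) deg_in (x |: B) y = \sum_(y in B) (adj x y + deg_in B y).
  by apply: eq_bigr => y _; rewrite !deg_in_sum big_setU1 //= adj_sym.
rewrite big_split /= -deg_in_sum; lia.
Qed.

Lemma deg_sumD1 A x : x \in A -> deg_sum A = deg_sum (A :\ x) + 2 * deg_in A x.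
Proof.
by move=> xA; rewrite -{1 3}(setD1K xA) deg_inU1 deg_sumU1 // !inE eqxx.
Qed.

(** * Two ways of finding dissociation sets *)

(** Deleting a vertex of degree at least [k] lowers [a * #|A| + deg_sum A] by
    at least [a + 2 * k], which pays for the [c] that it adds on the left. *)
Lemma delete_large_degrees (a k c : nat) : c <= a + 2 * k ->
  (forall A, (forall x, x \in A -> deg_in A x < k) ->
     exists2 D : {set G}, D \subset A /\ dissociated D &
       c * #|A :\: D| <= a * #|A| + deg_sum A) ->
  forall A, exists2 D : {set G}, D \subset A /\ dissociated D &
    c * #|A :\: D| <= a * #|A| + deg_sum A.
Proof.
move=> cak small A; have [n] := ubnP #|A|; elim: n A => // n IHn A ltAn.
have [/existsP[x /andP[xA degx]]|/existsPn noBig] :=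
    boolP [exists x, (x \in A) && (k <= deg_in A x)]; last first.
  by apply: small => x xA; have := noBig x; rewrite xA ltnNge.
have cardA := cardsD1 x A; rewrite xA /= in cardA.
have [|D [DA disD] leD] := IHn (A :\ x); first lia.
exists D; first by split=> //; apply: subset_trans DA (subD1set _ _).
have xAD : x \in A :\: D.
  by rewrite inE xA andbT; apply/negP => /(subsetP DA); rewrite !inE eqxx.
have cardAD := cardsD1 x (A :\: D); rewrite xAD /= in cardAD.
rewrite (_ : (A :\: D) :\ x = (A :\ x) :\: D) in cardAD; last first.
  by apply/setP=> y; rewrite !inE; case: (y == x); case: (y \in D).
rewrite (deg_sumD1 xA); nia.
Qed.

(** In a partition into two sides with the fewest edges inside the sides, no
    vertex has more neighbours on its own side than on the other, since moving
    it across would save edges. *)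
Lemma max_cut A : exists2 X : {set G}, X \subset A &
  (forall x, x \in X -> deg_in X x <= deg_in (A :\: X) x) /\
  (forall x, x \in A :\: X -> deg_in (A :\: X) x <= deg_in X x).
Proof.
case: (@arg_minnP _ A (fun X => X \subset A)
         (fun X => deg_sum X + deg_sum (A :\: X))) => // X XA minX.
exists X => //; split=> x xX.
  have xA := subsetP XA x xX.
  have := minX (X :\ x) (subset_trans (subD1set _ _) XA).
  have -> : A :\: (X :\ x) = x |: (A :\: X).
    by apply/setP=> y; rewrite !inE; case: eqP => [->|//]; rewrite xA.
  rewrite (deg_sumD1 xX) deg_sumU1 ?inE ?xX //; lia.
have /andP[xNX xA] : (x \notin X) && (x \in A) by move: xX; rewrite inE.
have := minX (x |: X); rewrite subUset sub1set xA XA => /(_ isT).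
have -> : A :\: (x |: X) = (A :\: X) :\ x.
  by apply/setP=> y; rewrite !inE negb_or andbA.
rewrite (deg_sumD1 xX) deg_sumU1 //; lia.
Qed.

Lemma deg_inID A X x : X \subset A ->
  deg_in A x = deg_in X x + deg_in (A :\: X) x.
Proof.
move=> /setIidPr XA; rewrite !deg_in_sum (big_setID X) /=.
by rewrite XA.
Qed.

(** Both sides of a maximum cut are dissociation sets here, as twice the degree
    of a vertex inside its side is at most 3; the larger side is taken. *)
Lemma half_dissociation A : (forall x, x \in A -> deg_in A x < 4) ->
  exists2 D : {set G}, D \subset A /\ dissociated D & 2 * #|A :\: D| <= #|A|.
Proof.
move=> deg3; have [X XA [cutX cutAX]] := max_cut A.
have cardA := cardsID X A; rewrite (setIidPr XA) in cardA.
have [leX|ltX] := leqP (#|A :\: X|) #|X|.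
  exists X; last by lia.
  split=> // x xX; have := deg3 x (subsetP XA x xX).
  by have := cutX x xX; rewrite (deg_inID x XA); lia.
exists (A :\: X).
  split=> [|x xAX]; first exact: subsetDl.
  have := deg3 x (subsetP (subsetDl _ _) x xAX).
  by have := cutAX x xAX; rewrite (deg_inID x XA); lia.
by rewrite setDDr setDv set0U (setIidPr XA); lia.
Qed.

(** * The three bounds *)

Lemma dissociation_half_size A : exists2 D : {set G}, D \subset A /\ dissociated D &
  4 * #|A :\: D| <= deg_sum A.
Proof.
apply: (@delete_large_degrees 0 2 4) => // B degB.
by exists B; [split=> // x /degB | rewrite setDv cards0].
Qed.

Lemma dissociation_sixth A : exists2 D : {set G}, D \subset A /\ dissociated D &
  12 * #|A :\: D| <= 4 * #|A| + deg_sum A.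
Proof.
apply: (@delete_large_degrees 4 4 12) => // B degB.
have [leB|ltB] := leqP (deg_sum B) (2 * #|B|).
  by have [D disD leD] := dissociation_half_size B; exists D => //; lia.
by have [D disD leD] := half_dissociation degB; exists D => //; lia.
Qed.

Lemma dissociation_ninth A : exists2 D : {set G}, D \subset A /\ dissociated D &
  18 * #|A :\: D| <= 8 * #|A| + deg_sum A.
Proof.
apply: (@delete_large_degrees 8 5 18) => // B degB.
have leB : deg_sum B <= 4 * #|B|.
  by rewrite mulnC -sum_nat_const; apply: leq_sum => x /degB.
by have [D disD leD] := dissociation_sixth B; exists D => //; lia.
Qed.

(** * Covers and edges of the whole graph *)

(** The middle vertex of a path on three vertices of [D] would have two
    neighbours in [D]. *)
Lemma dissociated_cover D : dissociated D -> path_vertex_cover 3 (~: D).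
Proof.
move=> disD; apply/existsP => -[f /andP[/injectiveP f_inj /forallP f_adj]].
pose i0 := @Ordinal 3 0 isT; pose i1 := @Ordinal 3 1 isT.
pose i2 := @Ordinal 3 2 isT.
have fD i : val (f i) \in D by have := valP (f i); rewrite inE negbK.
have adj0 : adj (val (f i1)) (val (f i0)).
  by have /forallP/(_ i0)/implyP/(_ isT) := f_adj i1.
have adj2 : adj (val (f i1)) (val (f i2)).
  by have /forallP/(_ i2)/implyP/(_ isT) := f_adj i1.
have neq02 : val (f i0) != val (f i2).
  by apply/eqP => /val_inj/f_inj.
have := disD _ (fD i1); apply/negP; rewrite -ltnNge.
have card2 : #|[set val (f i0); val (f i2)]| = 2 by rewrite cards2 neq02.
apply: leq_trans (eq_leq (esym card2)) _.
apply: subset_leq_card; apply/subsetP=> y; rewrite !inE.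
by case/orP=> /eqP->; rewrite fD.
Qed.

(** Handshake: the pairs of adjacent vertices lie two by two over the edges. *)
Lemma deg_sum_setT : deg_sum [set: G] = 2 * graph_size G.
Proof.
pose e (p : G * G) := [set p.1; p.2].
have -> : deg_sum [set: G] = \sum_(p : G * G | adj p.1 p.2) 1.
  rewrite /deg_sum -(pair_big_dep predT (fun x y => adj x y) (fun _ _ => 1)) /=.
  apply: eq_big => [x|x _]; first by rewrite inE.
  by rewrite sum1_card; apply: eq_card => y; rewrite !inE.
rewrite (partition_big e (mem (edges G))) /=; last first.
  by move=> [x y] /= xy; apply/imset2P; exists x y; rewrite ?inE.
rewrite mulnC /graph_size -sum_nat_const; apply: eq_bigr => s.
case/imset2P=> x y _; rewrite !inE /= => xy ->.
have neq_xy : x != y by apply: contraTneq xy => ->; rewrite adj_irr.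
have <- : #|[set (x, y); (y, x)]| = 2 by rewrite cards2 xpair_eqE negb_and neq_xy.
rewrite sum1_card.
apply: eq_card => -[u v]; rewrite !inE /e unfold_in /= !xpair_eqE.
apply/andP/orP => [[uv /eqP uvxy]|].
  have := set22 u v; have := set21 u v; rewrite uvxy !inE.
  case/orP=> /eqP Eu /orP[] /eqP Ev; move: uv; rewrite Eu Ev ?adj_irr //.
    by rewrite !eqxx; left.
  by rewrite !eqxx; right.
case=> /andP[/eqP-> /eqP->]; split=> //; first by rewrite adj_sym.
by rewrite setUC.
Qed.

Lemma psi3_le : 9 * psi 3 G <= 4 * graph_order G + graph_size G.
Proof.
have [D [_ disD] leD] := dissociation_ninth [set: G].
have [_ /(_ _ (dissociated_cover disD))] := psiP G (isT : 0 < 3).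
by move: leD; rewrite setTD deg_sum_setT cardsT /graph_order; lia.
Qed.

End Dissociation.

Unset Implicit Arguments.

Local Open Scope ring_scope.

Theorem theorem5 (G : sgraph) (n m : nat)
    (hn : graph_order G = n) (hm : graph_size G = m) :
  (psi 3 G)%:R <= (4 * n%:R + m%:R) / 9 :> rat.
Proof.
rewrite Num.Theory.ler_pdivlMr // -!GRing.natrM -GRing.natrD Num.Theory.ler_nat.
by rewrite mulnC -hn -hm psi3_le.
Qed.
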